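(* Let $n\ge 1$, let $A$ be a real symmetric positive definite $n\times n$ matrix and let $d\ge 0$. Let $\mathrm{PD}(n)$ be the set of real symmetric positive definite $n\times n$ matrices. Then the Bures-Wasserstein ball $$\left\{X\in \mathrm{PD}(n)\;:\;\rho(A,X)\le d\right\}$$ is represented by the convex constraint set $$\mathcal{S}=\left\{(X,K)\in \mathrm{PD}(n)\times\mathbb{R}^{n\times n}\;:\;\begin{bmatrix}X & K^\top\\ K & I\end{bmatrix}\succeq 0\ \text{ and }\ \operatorname{Tr}(A)+\operatorname{Tr}(X)-2\operatorname{Tr}\left(\sqrt{A}\,K\right)\le d^2\right\},$$ that is, $\mathcal{S}$ is convex, and for every $X\in \mathrm{PD}(n)$ one has $\rho(A,X)\le d$ if and only if there exists $K\in\mathbb{R}^{n\times n}$ with $(X,K)\in\mathcal{S}$.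
   Context: For a real symmetric positive definite matrix $X$, $\sqrt{X}$ denotes its unique symmetric positive definite square root. $O(n)$ is the group of real orthogonal $n\times n$ matrices, $\|\cdot\|_F$ is the Frobenius norm, $I$ is the $n\times n$ identity matrix, and $M\succeq 0$ means that the symmetric matrix $M$ is positive semidefinite. The Bures-Wasserstein distance between positive definite matrices $A,B$ is $$\rho(A,B)=\min_{U,V\in O(n)}\left\|\sqrt{A}\,U-\sqrt{B}\,V\right\|_F .$$ *)

(* Defs.v *)
From HB Require Import structures.
From mathcomp Require Import all_boot all_order all_algebra.
From mathcomp Require Import boolp classical_sets reals convex.

Set Implicit Arguments.
Unset Strict Implicit.
Unset Printing Implicit Defensive.

Import Order.TTheory GRing.Theory Num.Theory.

Local Open Scope classical_set_scope.
Local Open Scope ring_scope.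

Definition psdmx (R : realType) (n : nat) : set 'M[R]_n :=
  [set M | M^T = M /\ forall x : 'cV[R]_n, 0 <= (x^T *m M *m x) 0 0].

Definition pdmx (R : realType) (n : nat) : set 'M[R]_n :=
  [set M | M^T = M /\ forall x : 'cV[R]_n, x != 0 -> 0 < (x^T *m M *m x) 0 0].

Definition orthomx (R : realType) (n : nat) : set 'M[R]_n :=
  [set U | U *m U^T = 1%:M].

(* The symmetric positive definite square root, selected by choice: it exists
   and is unique when [X] is positive definite; if there is none, the value
   is 0. *)
Definition sqrtmx (R : realType) (n : nat) (X : 'M[R]_n) : 'M[R]_n :=
  xget 0 [set S | pdmx S /\ S *m S = X].

(* The library's norm `|M| on matrices is the max norm, hence this one. *)
Definition frobenius (R : realType) (m n : nat) (M : 'M[R]_(m, n)) : R :=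
  Num.sqrt (\sum_i \sum_j M i j ^+ 2).

(* The least element of [D] (attained, unlike [inf D]); if there is none, the
   value is 0. *)
Definition minimum (R : realType) (D : set R) : R :=
  xget 0 (D `&` lbound D).

(* The minimum is attained, by compactness of the orthogonal group. *)
Definition bures_dist (R : realType) (n : nat) (A B : 'M[R]_n) : R :=
  minimum [set r | exists U V : 'M[R]_n, [/\ orthomx U, orthomx V &
    r = frobenius (sqrtmx A *m U - sqrtmx B *m V)]].

Definition bures_constraint (R : realType) (n : nat) (A : 'M[R]_n) (d : R) :
    set ('M[R]_n * 'M[R]_n) :=
  [set XK | let: (X, K) := XK in
    [/\ pdmx X,
        psdmx (block_mx X K^T K 1%:M) &
        \tr A + \tr X - 2 * \tr (sqrtmx A *m K) <= d ^+ 2]].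

(* Main.v *)
From HB Require Import structures.
From mathcomp Require Import all_boot all_order all_algebra.
From mathcomp Require Import spectral sesquilinear complex interval_inference.
From mathcomp Require Import ring lra.
Require Import Defs.
From mathcomp Require Import boolp classical_sets reals convex.

Set Implicit Arguments.
Unset Strict Implicit.
Unset Printing Implicit Defensive.

Import Order.TTheory GRing.Theory Num.Theory.

Local Open Scope classical_set_scope.
Local Open Scope ring_scope.

(** Let [S] and [T] be the positive definite square roots of [A] and [X].
    Expanding the Frobenius norm,
    [frobenius (S U - T V) ^ 2 = tr A + tr X - 2 tr (T S U V^T)], so computing
    the distance amounts to maximising the linear functional
    [W |-> tr (T S W)] over orthogonal [W]. By polar decomposition of [T S]
    ([procrustes_max]) the maximum exists, and it bounds the functional on
    all contractions, not only on orthogonal matrices.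

    On the other side, the block matrix is positive semidefinite exactly when
    its Schur complement [X - K^T K] is ([psdmx_block]). As [X = T T] with [T]
    invertible, this says that [W := K T^-1] is a contraction, and then
    [tr (S K) = tr (T S W)]. Hence minimising
    [tr A + tr X - 2 tr (S K)] over the admissible [K] gives the same optimal
    value, the squared distance ([bures_dist_sqr]), and it is attained at
    [K = Q T] with [Q] orthogonal.

    Convexity is immediate since all constraints are affine in [(X, K)].

    The existence of positive definite square roots ([pdmx_sqrt_exists]) is
    obtained by interpolating the fourth root on the spectrum. *)

(** * Squared norms, positive definite and orthogonal matrices *)

Definition sqnorm (R : realDomainType) (m : nat) (x : 'cV[R]_m) : R :=
  (x^T *m x) 0 0.

Lemma sqnormE (R : realDomainType) (m : nat) (x : 'cV[R]_m) :
  sqnorm x = \sum_i x i 0 ^+ 2.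
Proof. by rewrite /sqnorm mxE; apply: eq_bigr => i _; rewrite mxE expr2. Qed.

Lemma sqnorm_ge0 (R : realDomainType) (m : nat) (x : 'cV[R]_m) : 0 <= sqnorm x.
Proof. by rewrite sqnormE sumr_ge0// => i _; exact: sqr_ge0. Qed.

Lemma sqnorm_eq0 (R : realDomainType) (m : nat) (x : 'cV[R]_m) :
  (sqnorm x == 0) = (x == 0).
Proof.
apply/eqP/eqP => [|->]; last by rewrite /sqnorm mulmx0 mxE.
rewrite sqnormE => /eqP; rewrite psumr_eq0 => [/allP h|i _]; last first.
  exact: sqr_ge0.
apply/matrixP => i j; rewrite ord1 mxE.
by apply/eqP; rewrite -sqrf_eq0; apply: h; rewrite mem_index_enum.
Qed.

Lemma sqnorm_gt0 (R : realDomainType) (m : nat) (x : 'cV[R]_m) :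
  (0 < sqnorm x) = (x != 0).
Proof. by rewrite lt0r sqnorm_ge0 sqnorm_eq0 andbT. Qed.

Lemma sqnorm_mul (R : realDomainType) (m n : nat) (M : 'M[R]_(m, n))
    (x : 'cV[R]_n) :
  sqnorm (M *m x) = (x^T *m (M^T *m M) *m x) 0 0.
Proof. by rewrite /sqnorm trmx_mul !mulmxA. Qed.

Lemma pdmx_unit (R : realType) (n : nat) (M : 'M[R]_n) :
  pdmx M -> M \in unitmx.
Proof.
move=> [_ M_gt0]; rewrite unitmxE unitfE; apply/negP => /det0P [v v0 vM].
have := M_gt0 v^T; rewrite trmxK vM mul0mx mxE ltxx.
by rewrite -trmx0 (inj_eq trmx_inj) => /(_ v0).
Qed.

(** The quadratic form of [M^T M] is [sqnorm (M x)]. This gives the positivity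
    of the square root and makes the polar decomposition available. *)
Lemma gram_pdmx (R : realType) (n : nat) (M : 'M[R]_n) :
  M \in unitmx -> pdmx (M^T *m M).
Proof.
move=> Mu; split=> [|x x0]; first by rewrite trmx_mul trmxK.
rewrite -sqnorm_mul sqnorm_gt0; apply: contra x0 => /eqP Mx0.
by rewrite -(mulKmx Mu x) Mx0 mulmx0.
Qed.

Lemma orthomxT (R : realType) (n : nat) (U : 'M[R]_n) :
  orthomx U -> U^T *m U = 1%:M.
Proof. exact: mulmx1C. Qed.

Lemma orthomx_tr (R : realType) (n : nat) (U : 'M[R]_n) :
  orthomx U -> orthomx U^T.
Proof. by move=> /orthomxT; rewrite /orthomx /= trmxK. Qed.

Lemma orthomxM (R : realType) (n : nat) (U V : 'M[R]_n) :
  orthomx U -> orthomx V -> orthomx (U *m V).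
Proof.
rewrite /orthomx /= => oU oV.
by rewrite trmx_mul mulmxA -(mulmxA U) oV mulmx1.
Qed.

Lemma sqnorm_orthomx (R : realType) (n : nat) (U : 'M[R]_n) (x : 'cV[R]_n) :
  orthomx U -> sqnorm (U *m x) = sqnorm x.
Proof. by move=> /orthomxT oU; rewrite sqnorm_mul oU mulmx1. Qed.

(** * Square roots of positive definite matrices *)

Lemma interpolation (F : fieldType) (s : seq F) (f : F -> F) :
  exists p : {poly F}, {in s, forall x, p.[x] = f x}.
Proof.
elim: s => [|a s [p ps]]; first by exists 0.
have [as_|as_] := boolP (a \in s).
  by exists p => x; rewrite inE => /predU1P [->|]; exact: ps.
pose w := \prod_(b <- s) ('X - b%:P).
have wa : w.[a] != 0 by move: as_; rewrite -root_prod_XsubC.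
(* One Newton step: the correction vanishes on [s] and sets the value at [a]. *)
exists (p + ((f a - p.[a]) / w.[a])%:P * w) => x.
rewrite inE => /predU1P [->|xs]; rewrite !hornerE.
  by rewrite divfK// addrC subrK.
have /rootP -> : root w x by rewrite root_prod_XsubC.
by rewrite mulr0 addr0 ps.
Qed.

(** A polynomial in a real symmetric matrix depends only on its values on the
    spectrum: over the complex numbers the matrix is unitarily diagonalisable
    with real eigenvalues, and a polynomial with real coefficients that kills
    the diagonal kills the matrix. The list [s] collects the diagonal entries,
    each of which is an eigenvalue of the real matrix because the
    characteristic polynomial does not change under field extension. *)
Lemma symmetric_spectrum (R : rcfType) (n : nat) (M : 'M[R]_n.+1) :
  M^T = M -> exists2 s : seq R, all (eigenvalue M) s &
    forall p : {poly R}, all (root p) s -> horner_mx M p = 0.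
Proof.
move=> Msym; pose toC := real_complex R; pose Mc := map_mx toC M.
have Mc_herm : Mc \is hermsymmx.
  apply: realsym_hermsym; last first.
    by apply/mxOverP => i j; rewrite mxE; apply/complex_realP; exists (M i j).
  by apply/is_hermitianmxP; rewrite expr0 scale1r map_mx_id // map_trmx Msym.
pose P := spectralmx Mc; pose D := spectral_diag Mc.
have Pu : P \in unitmx by exact: spectral_unit.
have McE : Mc = invmx P *m diag_mx D *m P.
  exact/orthomx_spectralP/hermitian_normalmx.
have DE i : D 0 i = toC (complex.Re (D 0 i)).
  by rewrite /toC RRe_real//; apply/mxOverP/hermitian_spectral_diag_real.
exists [seq complex.Re (D 0 i) | i : 'I_n.+1].
  apply/allP => _ /mapP [i _ ->].
  suff : eigenvalue Mc (D 0 i).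
    by rewrite !eigenvalue_root_char DE -map_char_poly fmorph_root.
  apply/eigenvalueP; exists (row i P).
    rewrite -row_mul {1}McE !mulmxA mulmxV// mul1mx row_mul row_diag_mx.
    by rewrite -scalemxAl -rowE.
  apply/negP => /eqP Pi0; have := congr1 (row i) (mulmxV Pu).
  rewrite row_mul Pi0 mul0mx => /matrixP /(_ 0 i).
  by rewrite !mxE eqxx => /eqP; rewrite eq_sym oner_eq0.
move=> p /allP ps; apply/eqP; rewrite -(map_mx_eq0 toC) map_horner_mx.
rewrite -/Mc McE horner_mx_uconjC// horner_mx_diag.
suff -> : map_mx (horner (map_poly toC p)) D = 0.
  by rewrite linear0 mulmx0 mul0mx.
apply/rowP => i; rewrite !mxE DE horner_map.
have lam_i := map_f (fun i => complex.Re (D 0 i)) (mem_enum _ i).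
by have /rootP -> := ps _ lam_i; rewrite rmorph0.
Qed.

Lemma pdmx_eigenvalue_gt0 (R : realType) (n : nat) (M : 'M[R]_n) (a : R) :
  pdmx M -> eigenvalue M a -> 0 < a.
Proof.
move=> [_ M_gt0] /eigenvalueP [v vM v0].
have vT0 : v^T != 0 by rewrite -trmx0 (inj_eq trmx_inj).
have := M_gt0 _ vT0; rewrite trmxK vM -scalemxAl mxE.
suff -> : (v *m v^T) 0 0 = sqnorm v^T.
  by rewrite pmulr_lgt0// sqnorm_gt0.
by rewrite /sqnorm trmxK.
Qed.

Lemma horner_mx_tr (R : comNzRingType) (n : nat) (M : 'M[R]_n.+1)
    (p : {poly R}) :
  M^T = M -> (horner_mx M p)^T = horner_mx M p.
Proof.
move=> Msym; elim/poly_ind: p => [|p c IH]; first by rewrite rmorph0 trmx0.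
rewrite rmorphD rmorphM /= horner_mx_X horner_mx_C raddfD /= tr_scalar_mx.
congr (_ + _); rewrite -[LHS]/((_ *m _)^T) trmx_mul IH Msym.
by have := comm_horner_mx p (erefl (M * M)); exact.
Qed.

(** The square root is taken inside the algebra of polynomials in [M]. With [q]
    interpolating the fourth root on the spectrum, [T := q(M)] is symmetric
    and [T^4 = M]. The fourth root rather than the square root is what makes
    positivity free: [T *m T] is the Gram matrix of the invertible [T]. *)
Lemma pdmx_sqrt_exists (R : realType) (n : nat) (M : 'M[R]_n) :
  pdmx M -> exists S : 'M[R]_n, pdmx S /\ S *m S = M.
Proof.
case: n M => [|n] M Mpd.
  by exists M; split=> //; rewrite [RHS]flatmx0 [LHS]flatmx0.
have Msym : M^T = M by case: Mpd.
have [s sM sP] := symmetric_spectrum Msym.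
have [q qs] := interpolation s (fun x => Num.sqrt (Num.sqrt x)).
pose T := horner_mx M q.
have Tsym : T^T = T by exact: horner_mx_tr.
have TM : (T *m T) *m (T *m T) = M.
  apply/eqP; rewrite -subr_eq0.
  have -> : T *m T *m (T *m T) - M = horner_mx M (q * q * (q * q) - 'X).
    by rewrite rmorphB !rmorphM /= horner_mx_X.
  apply/eqP/sP/allP => x xs; have x0 : 0 < x.
    by apply: (pdmx_eigenvalue_gt0 Mpd); exact: (allP sM).
  rewrite /root !(hornerD, hornerN, hornerM, hornerX) qs// -!expr2.
  by rewrite sqr_sqrtr ?sqrtr_ge0// sqr_sqrtr ?subrr// ltW.
have Tu : T \in unitmx.
  by have := pdmx_unit Mpd; rewrite -{1}TM !unitmx_mul => /andP [/andP []].
exists (T *m T); split=> //.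
by rewrite -{1}Tsym; exact: gram_pdmx.
Qed.

Lemma sqrtmxP (R : realType) (n : nat) (M : 'M[R]_n) :
  pdmx M -> pdmx (sqrtmx M) /\ sqrtmx M *m sqrtmx M = M.
Proof. by move=> /pdmx_sqrt_exists h; exact: (xgetPex 0 h). Qed.

(** * Traces against contractions *)

Lemma dotC (R : realDomainType) (m : nat) (x y : 'cV[R]_m) :
  (x^T *m y) 0 0 = (y^T *m x) 0 0.
Proof. by rewrite -[x in RHS]trmxK -trmx_mul [RHS]mxE. Qed.

Lemma sqnormD (R : realDomainType) (m : nat) (x y : 'cV[R]_m) :
  sqnorm (x + y) = sqnorm x + sqnorm y + 2 * (x^T *m y) 0 0.
Proof.
rewrite /sqnorm [(x + y)^T]linearD /= mulmxDl !mulmxDr !mxE.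
have := dotC x y; rewrite !mxE => ->.
ring.
Qed.

Lemma sqnormN (R : realDomainType) (m : nat) (x : 'cV[R]_m) :
  sqnorm (- x) = sqnorm x.
Proof. by rewrite /sqnorm [(- x)^T]linearN /= mulNmx mulmxN opprK. Qed.

Definition contraction (R : realDomainType) (m n : nat)
    (W : 'M[R]_(m, n)) : Prop :=
  forall x : 'cV[R]_n, sqnorm (W *m x) <= sqnorm x.

(** Expand [sqnorm (x - W x) >= 0] and bound [sqnorm (W x)] by [sqnorm x];
    this stands in for the Cauchy-Schwarz inequality. *)
Lemma contraction_quad_le (R : realDomainType) (n : nat) (W : 'M[R]_n)
    (x : 'cV[R]_n) :
  contraction W -> (x^T *m W *m x) 0 0 <= sqnorm x.
Proof.
move=> /(_ x) Wx; have := sqnorm_ge0 (x - W *m x).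
rewrite sqnormD sqnormN mulmxN mxE -mulmxA; lra.
Qed.

(** Writing [H = L L] with [L] symmetric, [tr (H C) = tr (L C L)] is the sum
    over the columns [l] of [L] of [l^T C l], each at most [sqnorm l]. *)
Lemma contraction_tr_le (R : realType) (n : nat) (H C : 'M[R]_n) :
  pdmx H -> contraction C -> \tr (H *m C) <= \tr H.
Proof.
move=> /sqrtmxP [[Lsym _]]; set L := sqrtmx H in Lsym * => LL Cle.
rewrite -LL -mulmxA mxtrace_mulC /mxtrace; apply: ler_sum => i _.
(* Used for [D = C], and for [D = 1] to read [sqnorm] of a column. *)
have trE (D : 'M[R]_n) : (L *m D *m L) i i = ((col i L)^T *m D *m col i L) 0 0.
  rewrite tr_col Lsym -row_mul [LHS]mxE [RHS]mxE.
  by apply: eq_bigr => j _; rewrite [row _ _ _ _]mxE [col _ _ _ _]mxE.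
have := contraction_quad_le (col i L) Cle.
rewrite -trE; congr (_ <= _).
by have := trE 1%:M; rewrite !mulmx1 => ->.
Qed.

(** This is the orthogonal Procrustes problem, solved by polar decomposition.
    Let [H] be the square root of [M^T M]. Then [M = Q^T H] for an orthogonal
    [Q], so [tr (M Q) = tr H], while [tr (M W) = tr (H W Q^T)] and [W Q^T] is
    again a contraction. Orthogonal matrices being contractions, the maximum
    over the orthogonal group equals the maximum over its convex hull, the
    contractions; this is what makes the ball representable by a convex set. *)
Lemma procrustes_max (R : realType) (n : nat) (M : 'M[R]_n) :
  M \in unitmx -> exists2 Q : 'M[R]_n, orthomx Q &
    forall W : 'M[R]_n, contraction W -> \tr (M *m W) <= \tr (M *m Q).
Proof.
move=> Mu; have [Hpd HH] := sqrtmxP (gram_pdmx Mu).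
set H := sqrtmx _ in Hpd HH; have Hu := pdmx_unit Hpd.
have Hsym : H^T = H by case: Hpd.
pose Q := invmx H *m M^T.
have oQ : orthomx Q.
  rewrite /orthomx /= trmx_mul trmxK trmx_inv Hsym -mulmxA (mulmxA M^T) -HH.
  by rewrite mulmxK// mulVmx.
have ME : M = Q^T *m H.
  by rewrite trmx_mul trmxK trmx_inv Hsym mulmxKV.
exists Q => // W Wle.
have -> : \tr (M *m Q) = \tr H.
  by rewrite ME mxtrace_mulC mulmxA oQ mul1mx.
rewrite ME -mulmxA mxtrace_mulC -mulmxA; apply: contraction_tr_le => // x.
by rewrite -mulmxA (le_trans (Wle _))// sqnorm_orthomx//; exact: orthomx_tr.
Qed.

(** * The Bures-Wasserstein distance *)

Lemma frobenius_sqr (R : realType) (m n : nat) (M : 'M[R]_(m, n)) :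
  frobenius M ^+ 2 = \tr (M *m M^T).
Proof.
rewrite sqr_sqrtr; last by do 2!apply: sumr_ge0 => ? _; exact: sqr_ge0.
rewrite /mxtrace; apply: eq_bigr => i _; rewrite mxE.
by apply: eq_bigr => j _; rewrite mxE expr2.
Qed.

Lemma frobenius_orthomx (R : realType) (n : nat) (S T U V : 'M[R]_n) :
  S^T = S -> T^T = T -> orthomx U -> orthomx V ->
  frobenius (S *m U - T *m V) ^+ 2 =
    \tr (S *m S) + \tr (T *m T) - 2 * \tr (T *m S *m (U *m V^T)).
Proof.
move=> Ssym Tsym oU oV; rewrite frobenius_sqr.
rewrite [(_ - _)^T]raddfB /= !trmx_mul Ssym Tsym mulmxBl !mulmxBr.
have trB (P Q : 'M[R]_n) : \tr (P - Q) = \tr P - \tr Q by rewrite raddfB.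
rewrite !trB.
have -> : S *m U *m (U^T *m S) = S *m S by rewrite mulmxA -(mulmxA S) oU mulmx1.
have -> : T *m V *m (V^T *m T) = T *m T by rewrite mulmxA -(mulmxA T) oV mulmx1.
have -> : \tr (T *m V *m (U^T *m S)) = \tr (S *m U *m (V^T *m T)).
  by rewrite -mxtrace_tr !trmx_mul !trmxK Ssym Tsym.
have -> : \tr (S *m U *m (V^T *m T)) = \tr (T *m S *m (U *m V^T)).
  by rewrite mulmxA mxtrace_mulC !mulmxA.
ring.
Qed.

(** * The block constraint as a Schur complement *)

(** Completing the square in [v]. *)
Lemma schur_quad (R : realDomainType) (m n : nat) (X : 'M[R]_n)
    (K : 'M[R]_(m, n)) (u : 'cV[R]_n) (v : 'cV[R]_m) :
  ((col_mx u v)^T *m block_mx X K^T K 1%:M *m col_mx u v) 0 0 =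
    (u^T *m X *m u) 0 0 - sqnorm (K *m u) + sqnorm (K *m u + v).
Proof.
rewrite tr_col_mx mul_row_block mul_row_col mulmx1 sqnormD (dotC _ v).
rewrite !mulmxDl !mulmxA [LHS]mxE [X in X + _]mxE [X in _ + X]mxE.
have -> : sqnorm v = (v^T *m v) 0 0 by [].
have -> : (u^T *m K^T *m v) 0 0 = (v^T *m K *m u) 0 0.
  by rewrite -trmx_mul dotC mulmxA.
ring.
Qed.

(** Schur complement: [schur_quad] is least at [v = - K u], where the square
    vanishes. *)
Lemma psdmx_block (R : realType) (m n : nat) (X : 'M[R]_n)
    (K : 'M[R]_(m, n)) : X^T = X ->
  psdmx (block_mx X K^T K 1%:M) <->
  forall u : 'cV[R]_n, sqnorm (K *m u) <= (u^T *m X *m u) 0 0.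
Proof.
move=> Xsym; split=> [[_ psd] u|KX].
  have := psd (col_mx u (- (K *m u))); rewrite schur_quad subrr.
  by rewrite /sqnorm mulmx0 [(0 : 'M_1) 0 0]mxE addr0 subr_ge0.
split=> [|x]; first by rewrite tr_block_mx Xsym trmxK tr_scalar_mx.
by rewrite -[x]vsubmxK schur_quad addr_ge0 ?sqnorm_ge0// subr_ge0.
Qed.

(** Expanding the Frobenius norm, the squared objective depends on [U] and [V]
    only through [tr (T S U V^T)], with [S] and [T] the roots of [A] and [X].
    The pair [(Q, 1)] with [Q] from [procrustes_max] therefore attains the
    minimum, so the distance is a genuine minimum rather than the default
    value 0. The last clause compares [Q] with all contractions because these
    are what the block constraint on [K] describes. *)
Lemma bures_dist_sqr (R : realType) (n : nat) (A X : 'M[R]_n) :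
  pdmx A -> pdmx X ->
  exists Q : 'M[R]_n, [/\ orthomx Q, 0 <= bures_dist A X,
    bures_dist A X ^+ 2 =
      \tr A + \tr X - 2 * \tr (sqrtmx X *m sqrtmx A *m Q) &
    forall W, contraction W ->
      \tr (sqrtmx X *m sqrtmx A *m W) <= \tr (sqrtmx X *m sqrtmx A *m Q)].
Proof.
move=> Apd Xpd; have [Spd SS] := sqrtmxP Apd; have [Tpd TT] := sqrtmxP Xpd.
set S := sqrtmx A in Spd SS *; set T := sqrtmx X in Tpd TT *.
have [Q oQ Qmax] : exists2 Q : 'M[R]_n, orthomx Q & forall W,
    contraction W -> \tr (T *m S *m W) <= \tr (T *m S *m Q).
  by apply: procrustes_max; rewrite unitmx_mul !pdmx_unit.
have Ssym : S^T = S by case: Spd.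
have Tsym : T^T = T by case: Tpd.
have frobE U V := @frobenius_orthomx R n S T U V Ssym Tsym.
have oI : orthomx (1%:M : 'M[R]_n) by rewrite /orthomx /= trmx1 mulmx1.
set D := [set r | exists U V : 'M[R]_n, [/\ orthomx U, orthomx V &
    r = frobenius (S *m U - T *m V)]].
have frob_ge0 (M : 'M[R]_n) : 0 <= frobenius M by exact: sqrtr_ge0.
have r0P : (D `&` lbound D) (frobenius (S *m Q - T *m 1%:M)).
  split=> [|_ [U [V [oU oV ->]]]]; first by exists Q, 1%:M.
  rewrite -(@ler_pXn2r _ 2) ?nnegrE// !frobE// trmx1 mulmx1.
  rewrite lerD2l lerN2 ler_pM2l// Qmax// => x.
  by rewrite sqnorm_orthomx//; apply: orthomxM => //; exact: orthomx_tr.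
have bE : bures_dist A X = frobenius (S *m Q - T *m 1%:M).
  have [bD blb] := xgetPex 0 (ex_intro _ _ r0P).
  by apply/le_anti/andP; split; [exact: blb r0P.1 | exact: r0P.2].
exists Q; split=> //; first by rewrite bE.
by rewrite bE frobE// SS TT trmx1 (mulmx1 Q).
Qed.

(** * The constraint set *)

Lemma quad_conv (R : realDomainType) (n : nat) (M N : 'M[R]_n) (a b : R)
    (x : 'cV[R]_n) :
  (x^T *m (a *: M + b *: N) *m x) 0 0 =
    a * (x^T *m M *m x) 0 0 + b * (x^T *m N *m x) 0 0.
Proof.
rewrite mulmxDr mulmxDl -!scalemxAr -!scalemxAl mxE [in LHS]mxE.
by rewrite [X in _ + X]mxE.
Qed.

(** Every constraint is the nonnegativity or positivity of an expression affine
    in [(X, K)]; the terms [1], [tr A] and [d ^ 2] that do not scale are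
    absorbed by the weights summing to [1]. *)
Lemma bures_constraint_convex (R : realType) (n : nat) (A : 'M[R]_n) (d : R) :
  convex_set (M := ('M[R]_n * 'M[R]_n)%type) (bures_constraint A d).
Proof.
apply/convex_setW => -[X K] [Y L] /set_mem [[Xs Xpd] [_ Xpsd] Xd].
move=> /set_mem [[Ys Ypd] [_ Ypsd] Yd] k k_gt0 k_lt1; apply/mem_set.
set t := k%:num in k_gt0 k_lt1.
pose s := 1 - t; have s_gt0 : 0 < s by rewrite subr_gt0.
have ts : t + s = 1 by rewrite addrC subrK.
change (bures_constraint A d (t *: X + s *: Y, t *: K + s *: L)).
have Zs : (t *: X + s *: Y)^T = t *: X + s *: Y.
  by rewrite linearD !linearZ /= Xs Ys.
split; first split=> // x x0.
- by rewrite quad_conv addr_gt0// mulr_gt0// ?Xpd ?Ypd.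
- have -> : block_mx (t *: X + s *: Y) (t *: K + s *: L)^T
      (t *: K + s *: L) 1%:M =
      t *: block_mx X K^T K 1%:M + s *: block_mx Y L^T L 1%:M.
    rewrite !scale_block_mx add_block_mx linearD !linearZ /=.
    by rewrite -scalerDl ts scale1r.
  split=> [|x].
    by rewrite linearD !linearZ /= !tr_block_mx !trmxK !trmx1 Xs Ys.
  by rewrite quad_conv addr_ge0// mulr_ge0// ltW.
rewrite mulmxDr -!scalemxAr !linearD !linearZ /=.
have Xt := ler_wpM2l (ltW k_gt0) Xd; have Yt := ler_wpM2l (ltW s_gt0) Yd.
have := lerD Xt Yt; rewrite -[X in _ <= X]mulrDl ts mul1r.
congr (_ <= _).
rewrite /s; ring.
Qed.

Theorem mainTheorem3 (R : realType) (n : nat) (hn : (1 <= n)%N)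
    (A : 'M[R]_n) (hA : pdmx A) (d : R) (hd : 0 <= d) :
  convex_set (M := ('M[R]_n * 'M[R]_n)%type) (bures_constraint A d) /\
  (forall X : 'M[R]_n, pdmx X ->
     (bures_dist A X <= d <-> exists K : 'M[R]_n, bures_constraint A d (X, K))).
Proof.
split=> [|X hX]; first exact: bures_constraint_convex.
have Xsym : X^T = X by case: hX.
have [Q [oQ b_ge0 bE Qmax]] := bures_dist_sqr hA hX.
have [Tpd TT] := sqrtmxP hX; set T := sqrtmx X in Tpd TT bE Qmax.
have Tsym : T^T = T by case: Tpd.
have Tu := pdmx_unit Tpd.
have TX u : sqnorm (T *m u) = (u^T *m X *m u) 0 0 by rewrite sqnorm_mul Tsym TT.
have trK W : \tr (sqrtmx A *m (W *m T)) = \tr (T *m sqrtmx A *m W).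
  by rewrite mulmxA mxtrace_mulC mulmxA.
rewrite -(@ler_pXn2r _ 2) ?nnegrE//; split=> [bd|[K [_ /psdmx_block KX Kd]]].
  (* The optimal contraction, transported to a feasible [K].
     Here [K^T K = X], so the Schur complement is 0. *)
  exists (Q *m T); split; rewrite ?trK -?bE//.
  by apply/psdmx_block => // u; rewrite -mulmxA sqnorm_orthomx// TX.
(* Conversely [K = (K T^-1) T], and positivity of the block matrix says that
   [K T^-1] is a contraction. *)
apply: le_trans Kd; rewrite -(mulmxKV Tu K) trK bE.
rewrite lerD2l lerN2 ler_pM2l// Qmax// => x.
by rewrite -mulmxA (le_trans (KX Xsym _))// -TX mulKVmx.
Qed.
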